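(* Let $m$ be a positive integer, $\epsilon>0$, $R=m\epsilon$, and $\mathcal{Y}=\{-m\epsilon,(-m+1)\epsilon,\dots,m\epsilon\}\subset\mathbb{R}$. Let $Q$ be an irreducible aperiodic Markov transition matrix on $\mathcal{Y}$ and $\nu$ a probability measure on $\mathcal{Y}$ reversible with respect to $Q$. For a positive integer $n$ let $\mathcal{X}_n=\mathcal{Y}^{n+1}$, with path measure $\mu_n$ and Glauber dynamics $P_n$ (as defined in the context), and let $\lambda_1>0$ be a constant such that $\Lambda^{(1)}_{\mu_n}(P_n)\ge\frac{\lambda_1}{n+1}$. Let $k_1,k_2\in\mathbb{Z}$ with $0<k_1<k_2<(n+1)/2$ and define $f_n:\mathcal{X}_n\to\mathbb{R}$ by $$f_n(x_0,\dots,x_n)=\frac1{n+1}\sum_{k=k_1}^{k_2}\big|\phi_{(x_0,\dots,x_n)}(k)\big|^2,\qquad \phi_{(x_0,\dots,x_n)}(k)=\frac1{\sqrt{n+1}}\sum_{t=0}^n\exp\left(\frac{-2\pi i kt}{n+1}\right)x_t .$$ Then for every $a\ge0$, $$\ln\left(\mathcal{F}^+_{\mu_n}\Big(f_n;\frac{a}{\sqrt{n+1}}\Big)\right)\le\varkappa-\vartheta\left(a\cdot\frac{\sqrt{\lambda_1}}{R^2}\right).$$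
   Context: Here $i=\sqrt{-1}$. Path measure: $\mu_n(x_0,\dots,x_n)=\nu(x_0)Q(x_0,x_1)\cdots Q(x_{n-1},x_n)$. Standing assumption: $\mu_n$ is non-degenerate, i.e. $\mu_n(x)>0$ for all $x\in\mathcal{X}_n$. Reversibility of $\nu$: $\nu(x)Q(x,y)=\nu(y)Q(y,x)$ for all $x,y\in\mathcal{Y}$. Glauber dynamics: with $x=(x_0,\dots,x_n)$, $y=(y_0,\dots,y_n)$ and $\delta$ the Kronecker delta, $P_n(x,y)=\frac1{n+1}\sum_{t=0}^nP_{n,t}(x,y)$, where $P_{n,t}$ resamples the coordinate $t$ from its conditional distribution under $\mu_n$ given the others: for $1\le t\le n-1$, $$P_{n,t}(x,y)=\frac{Q(x_{t-1},y_t)Q(y_t,x_{t+1})}{\sum_{z\in\mathcal{Y}}Q(x_{t-1},z)Q(z,x_{t+1})}\prod_{s\ne t}\delta(x_s,y_s),$$ $$P_{n,0}(x,y)=\frac{\nu(y_0)Q(y_0,x_1)}{\sum_{z\in\mathcal{Y}}\nu(z)Q(z,x_1)}\prod_{s\neq 0}\delta(x_s,y_s),\qquad P_{n,n}(x,y)=Q(x_{n-1},y_n)\prod_{s\ne n}\delta(x_s,y_s).$$ The measure $\mu_n$ is reversible for $P_n$. The spectral gap is $\Lambda^{(1)}_{\mu_n}(P_n)=\min\{\mathcal{E}(g,g): g:\mathcal{X}_n\to\mathbb{R},\ \operatorname{Var}_{\mu_n}(g)\ge1\}$ with $\mathcal{E}(g,g)=\frac12\sum_{x,y\in\mathcal{X}_n}(g(x)-g(y))^2\mu_n(x)P_n(x,y)$.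 For $a\ge0$, $\mathcal{F}^+_{\mu_n}(f;a)=\mu_n(\{x:f(x)-\mathbb{E}_{\mu_n}[f]\ge a\})$, with $\ln0=-\infty$. The constant is $\varkappa=\sum_{k=1}^\infty2^k\ln\left(\frac1{1-4^{-k}}\right)$, and $\vartheta(x)=x\,\varphi(x)+\ln\left(\frac2x\varphi(x)\right)$ with $\varphi(x)=\sqrt{1+\frac1{x^2}}-\frac1x$ for $x>0$, and $\vartheta(0)=0$ (continuous extension). *)

(* Defs.v *)
From HB Require Import structures.
From mathcomp Require Import all_boot all_order all_algebra.
From mathcomp Require Import complex.
From mathcomp Require Import all_classical all_reals all_analysis.

Set Implicit Arguments.
Unset Strict Implicit.
Unset Printing Implicit Defensive.

Import Order.TTheory GRing.Theory Num.Theory.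

Local Open Scope classical_set_scope.
Local Open Scope ring_scope.

Section FiniteSpace.
Variables (R : realType) (T : finType).
Implicit Types (mu f g : T -> R) (P : T -> T -> R).

Definition prob_mass mu := (forall x, 0 <= mu x) /\ \sum_x mu x = 1.

Definition mass_mean mu f : R := \sum_x mu x * f x.

Definition mass_variance mu f : R := \sum_x mu x * (f x - mass_mean mu f) ^+ 2.

Definition dirichlet_form mu P g : R :=
  2^-1 * \sum_x \sum_y (g x - g y) ^+ 2 * mu x * P x y.

(* When mu charges two points the infimum is a minimum: the form is invariant
   under adding constants to g, and quadratic in g on a finite-dimensional
   space.  If mu were a point mass the set would be empty and inf would be 0. *)
Definition spectral_gap mu P : R :=
  inf [set dirichlet_form mu P g | g in [set g : T -> R | 1 <= mass_variance mu g]].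

Definition upper_deviation mu f (a : R) : R :=
  \sum_(x | a <= f x - mass_mean mu f) mu x.

End FiniteSpace.

(* Markov chains on the state space 'I_N.+1; Q ^+ k is the k-step matrix. *)
Section Chain.
Variables (R : realType) (N : nat).
Local Notation Y := 'I_N.+1.
Implicit Types (Q : 'M[R]_N.+1) (nu : Y -> R).

Definition markov_matrix Q :=
  (forall x y, 0 <= Q x y) /\ (forall x, \sum_y Q x y = 1).

Definition irreducible_chain Q := forall x y, exists k : nat, 0 < (Q ^+ k) x y.

(* The gcd of the possible return times to each state is 1. *)
Definition aperiodic_chain Q := forall (x : Y) (d : nat),
  (forall k : nat, (0 < k)%N -> 0 < (Q ^+ k) x x -> (d %| k)%N) -> d = 1%N.

Definition reversible_chain nu Q := forall x y, nu x * Q x y = nu y * Q y x.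

End Chain.

Section Path.
Variables (R : realType) (N n : nat).
Local Notation Y := 'I_N.+1.
Local Notation X := {ffun 'I_n.+1 -> 'I_N.+1}.
Implicit Types (Q : 'M[R]_N.+1) (nu : Y -> R) (x y : X).

Definition path_measure nu Q x : R :=
  nu (x ord0) * \prod_(t < n) Q (x (inord t)) (x (inord t.+1)).

(* The weight that the Glauber update at time t gives to the value z, up to
   normalization.  For t = n no normalization is needed, Q being stochastic. *)
Definition glauber_at nu Q (t : 'I_n.+1) x y : R :=
  (if t == ord0 then
     (nu (y ord0) * Q (y ord0) (x (inord 1)))
       / \sum_(z : Y) nu z * Q z (x (inord 1))
   else if t == ord_max then
     Q (x (inord n.-1)) (y ord_max)
   else
     (Q (x (inord t.-1)) (y t) * Q (y t) (x (inord t.+1)))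
       / \sum_(z : Y) Q (x (inord t.-1)) z * Q z (x (inord t.+1)))
  * \prod_(s < n.+1 | s != t) (x s == y s)%:R.

Definition glauber nu Q x y : R :=
  n.+1%:R^-1 * \sum_(t < n.+1) glauber_at nu Q t x y.

End Path.

Section Spectrum.
Variable R : realType.
Local Open Scope complex_scope.

Definition cexp (z : R[i]) : R[i] :=
  (expR (complex.Re z))%:C
    * (cos (complex.Im z) +i* sin (complex.Im z)).

(* The elements -m eps, (-m + 1) eps, ..., m eps, indexed by 0, ..., 2 m. *)
Definition state (m : nat) (eps : R) (i : 'I_(m.*2.+1)) : R :=
  (i%:R - m%:R) * eps.

Variables (m n : nat) (eps : R).
Implicit Type x : {ffun 'I_n.+1 -> 'I_(m.*2.+1)}.

Definition fourier x (k : nat) : R[i] :=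
  ((Num.sqrt n.+1%:R)^-1)%:C *
  \sum_(t < n.+1) cexp (- 2 * pi%:C * 'i * k%:R * t%:R / n.+1%:R)
                  * (state eps (x t))%:C.

Definition spectral_power (k1 k2 : nat) x : R :=
  n.+1%:R^-1 *
  \sum_(k1 <= k < k2.+1) (ComplexField.Normc.normc (fourier x k)) ^+ 2.

End Spectrum.

Section Constants.
Variable R : realType.

Definition varkappa : R :=
  limn (fun K : nat => \sum_(1 <= k < K) 2 ^+ k * ln (1 / (1 - 4 ^- k))).

Definition varphi (x : R) : R := Num.sqrt (1 + 1 / x ^+ 2) - 1 / x.

Definition vartheta (x : R) : R :=
  if x == 0 then 0 else x * varphi x + ln (2 / x * varphi x).

End Constants.

(* Main.v *)
(* Applied to exp (s f), the Poincare inequality with constant L gives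
   M (2 s) (1 - s^2 C / L) <= M (s)^2 for the Laplace transform M of the centered
   f, where C bounds the sum over y of P (x, y) (f x - f y)_+^2.  Iterating down
   to s = 0 gives ln M (2 s) <= varkappa - ln (1 - s^2 C / L), and in the Chernoff
   bound the exponent is optimal at s^2 C / L = varphi^2, which yields vartheta.

   For the spectral power, f x = <x, B x> / (n + 1), where B is half an orthogonal
   projection because 0 < k < (n + 1) / 2.  By convexity, changing x_t alone lowers
   f by at most 2 |(B x)_t| 2 R / (n + 1); as |B x|^2 <= |x|^2 / 4 <= (n + 1) R^2 / 4,
   averaging over t gives C = 4 R^4 / (n + 1)^2. *)

Require Import Defs.
From HB Require Import structures.
From mathcomp Require Import all_boot all_order all_algebra.
From mathcomp Require Import complex.
From mathcomp Require Import all_classical all_reals all_analysis.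
From mathcomp Require Import ring lra zify.

Set Implicit Arguments.
Unset Strict Implicit.
Unset Printing Implicit Defensive.

Import Order.TTheory GRing.Theory Num.Theory.
Import numFieldNormedType.Exports.

Local Open Scope ring_scope.

(** * Concentration from a spectral gap *)

(** For $v\le u$, $e^u-e^v=e^u(1-e^{v-u})\le e^u(u-v)$, and one of the two positive parts always
    vanishes. The one-sided form lets a bound on the decreases of [f] alone control the Dirichlet
    form. *)
Lemma expR_sub_sqr_le (R : realType) (a b : R) :
  (expR a - expR b) ^+ 2 <=
  expR (2 * a) * Num.max 0 (a - b) ^+ 2 + expR (2 * b) * Num.max 0 (b - a) ^+ 2.
Proof.
have aux (u v : R) : v <= u ->
    (expR u - expR v) ^+ 2 <= expR (2 * u) * (u - v) ^+ 2.
  move=> vu; rewrite mulr_natl mulr2n expRD -expr2 -exprMn.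
  have h1 : 0 <= expR u - expR v by rewrite subr_ge0 ler_expR.
  apply: lerXn2r; rewrite ?nnegrE //.
    by rewrite mulr_ge0 ?expR_ge0 ?subr_ge0.
  have -> : expR v = expR u * expR (v - u) by rewrite -expRD addrC subrK.
  have := expR_ge1Dx (v - u); have := expR_gt0 u; nra.
have [ab|/ltW ba] := lerP a b.
- rewrite (max_l (_ : a - b <= 0)) ?subr_le0 // (max_r (_ : 0 <= b - a)) ?subr_ge0 //.
  by rewrite expr0n /= mulr0 add0r -sqrrN opprB aux.
- rewrite (max_r (_ : 0 <= a - b)) ?subr_ge0 // (max_l (_ : b - a <= 0)) ?subr_le0 //.
  by rewrite expr0n /= mulr0 addr0 aux.
Qed.

(** Both links of $e^z-1-z\le z(e^z-1)\le z^2e^{|z|}$ follow from $e^t\ge 1+t$. *)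
Lemma expR_quad_le (R : realType) (z : R) :
  expR z <= 1 + z + z ^+ 2 * expR `|z|.
Proof.
have h (w : R) : w * (expR w - 1) <= w ^+ 2 * expR `|w|.
  have hw := expR_ge1Dx w; have hNw := expR_ge1Dx (- w).
  have [w0|w0] := lerP 0 w.
  - rewrite expr2 -mulrA ler_wpM2l // ger0_norm //.
    have e : expR w * expR (- w) = 1 by rewrite -expRD subrr expR0.
    by have := expR_gt0 w; nra.
  - rewrite ltr0_norm //; nra.
have e : expR z * expR (- z) = 1 by rewrite -expRD subrr expR0.
have := h z; have := expR_gt0 z; have := expR_ge1Dx (- z); nra.
Qed.

Section Concentration.
Variables (R : realType) (T : finType) (mu : T -> R) (P : T -> T -> R).
Hypothesis mu_prob : prob_mass mu.
Hypothesis P_ge0 : forall x y, 0 <= P x y.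
Hypothesis P_rev : forall x y, mu x * P x y = mu y * P y x.
Implicit Type f g : T -> R.

Let mu_ge0 x : 0 <= mu x. Proof. by case: mu_prob. Qed.
Let sum_mu : \sum_x mu x = 1. Proof. by case: mu_prob. Qed.

Lemma mass_varianceE g :
  mass_variance mu g = \sum_x mu x * g x ^+ 2 - (\sum_x mu x * g x) ^+ 2.
Proof.
rewrite /mass_variance /mass_mean; set e := \sum_x mu x * g x.
transitivity (\sum_x (mu x * g x ^+ 2 - (e * 2) * (mu x * g x) + e ^+ 2 * mu x)).
  by apply: eq_bigr => x _; ring.
by rewrite big_split sumrB /= -!mulr_sumr sum_mu -/e; ring.
Qed.

Lemma mass_variance_ge0 g : 0 <= mass_variance mu g.
Proof. by apply: sumr_ge0 => x _; rewrite mulr_ge0 ?sqr_ge0. Qed.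

Lemma dirichlet_form_ge0 g : 0 <= dirichlet_form mu P g.
Proof.
apply: mulr_ge0; first by rewrite invr_ge0.
apply: sumr_ge0 => x _; apply: sumr_ge0 => y _.
by rewrite mulr_ge0 // mulr_ge0 // sqr_ge0.
Qed.

Lemma mass_varianceZ c g :
  mass_variance mu (fun x => c * g x) = c ^+ 2 * mass_variance mu g.
Proof.
rewrite !mass_varianceE mulrBr -exprMn; congr (_ - _ ^+ 2); rewrite mulr_sumr;
  by apply: eq_bigr => x _; ring.
Qed.

Lemma dirichlet_formZ c g :
  dirichlet_form mu P (fun x => c * g x) = c ^+ 2 * dirichlet_form mu P g.
Proof.
rewrite /dirichlet_form mulrCA; congr (_ * _); rewrite mulr_sumr.
apply: eq_bigr => x _.
by rewrite mulr_sumr; apply: eq_bigr => y _; ring.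
Qed.

Lemma poincare lam g : 0 <= lam -> lam <= spectral_gap mu P ->
  lam * mass_variance mu g <= dirichlet_form mu P g.
Proof.
move=> lam_ge0 lam_le; have := mass_variance_ge0 g.
rewrite le_eqVlt => /predU1P[<-|v_gt0]; first by rewrite mulr0 dirichlet_form_ge0.
(* Rescaling to unit variance turns [g] into a competitor in the infimum. *)
set c := (Num.sqrt (mass_variance mu g))^-1.
have c2 : c ^+ 2 = (mass_variance mu g)^-1 by rewrite exprVn sqr_sqrtr ?ltW.
suff : lam <= dirichlet_form mu P (fun x => c * g x).
  by rewrite dirichlet_formZ c2 ler_pdivlMl // mulrC.
apply: (le_trans lam_le); apply: ge_inf.
  by exists 0 => _ [h _ <-]; exact: dirichlet_form_ge0.
by exists (fun x => c * g x) => //=; rewrite mass_varianceZ c2 mulVf // gt_eqF.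
Qed.

Variables (f : T -> R) (C2 lam : R).
Hypothesis C2_ge0 : 0 <= C2.
Hypothesis f_lip : forall x, \sum_y P x y * Num.max 0 (f x - f y) ^+ 2 <= C2.
Hypothesis lam_gt0 : 0 < lam.
Hypothesis lam_gap : lam <= spectral_gap mu P.

Definition mgf (s : R) : R := \sum_x mu x * expR (s * f x).

Lemma mgf_gt0 (s : R) : 0 < mgf s.
Proof.
have h0 : 0 <= mgf s by apply: sumr_ge0 => x _; rewrite mulr_ge0 ?expR_ge0.
rewrite lt_neqAle h0 andbT eq_sym; apply/eqP => h.
have : \sum_x mu x = 0.
  apply: big1 => x _; apply/eqP.
  have /eqP : mu x * expR (s * f x) = 0.
    by apply: (psumr_eq0P _ h) => // y _; rewrite mulr_ge0 ?expR_ge0.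
  by rewrite mulf_eq0 expR_eq0 orbF.
by rewrite sum_mu; apply/eqP; rewrite oner_eq0.
Qed.

(* By reversibility only the pairs with f y < f x matter, counted twice. *)
Lemma dirichlet_form_expR_le (s : R) : 0 <= s ->
  dirichlet_form mu P (fun x => expR (s * f x)) <= s ^+ 2 * C2 * mgf (2 * s).
Proof.
move=> s0; set w := fun x y => mu x * P x y * (expR (2 * (s * f x)) *
  Num.max 0 (s * f x - s * f y) ^+ 2).
have w_le : \sum_x \sum_y w x y <= s ^+ 2 * C2 * mgf (2 * s).
  rewrite /mgf mulr_sumr; apply: ler_sum => x _.
  have -> : \sum_y w x y = mu x * expR (2 * s * f x) * s ^+ 2 *
      (\sum_y P x y * Num.max 0 (f x - f y) ^+ 2).
    rewrite mulr_sumr; apply: eq_bigr => y _; rewrite /w.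
    have -> : Num.max 0 (s * f x - s * f y) = s * Num.max 0 (f x - f y).
      by rewrite -mulrBr -{1}(mulr0 s) maxr_pMr.
    by rewrite (mulrA 2 s); ring.
  have := f_lip x; set S := \sum_y _ => S_le.
  have -> : s ^+ 2 * C2 * (mu x * expR (2 * s * f x)) =
    mu x * expR (2 * s * f x) * s ^+ 2 * C2 by ring.
  by apply: ler_wpM2l => //; rewrite mulr_ge0 ?sqr_ge0 // mulr_ge0 ?expR_ge0.
rewrite /dirichlet_form ler_pdivrMl //; apply: (@le_trans _ _
  (\sum_x \sum_y (w x y + w y x))).
  apply: ler_sum => x _; apply: ler_sum => y _.
  rewrite /w -(P_rev x y) -mulrDr -mulrA mulrC.
  by apply: ler_wpM2l; rewrite ?mulr_ge0 ?expR_sub_sqr_le.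
under eq_bigr do rewrite big_split.
rewrite big_split /= [X in _ + X]exchange_big /=.
by rewrite mulr2n mulrDl mul1r lerD.
Qed.

(* The Poincare inequality for the test function expR (s * f x). *)
Lemma mgf_double (s : R) : 0 <= s ->
  mgf (2 * s) * (1 - s ^+ 2 * (C2 / lam)) <= mgf s ^+ 2.
Proof.
move=> s0; have := poincare (fun x => expR (s * f x)) (ltW lam_gt0) lam_gap.
move=> /le_trans /(_ (dirichlet_form_expR_le s0)).
rewrite mass_varianceE -/(mgf s).
have -> : \sum_x mu x * expR (s * f x) ^+ 2 = mgf (2 * s).
  by apply: eq_bigr => x _; rewrite -expRM_natl mulrA.
move=> h; rewrite -(ler_pM2l lam_gt0).
have -> : lam * (mgf (2 * s) * (1 - s ^+ 2 * (C2 / lam))) =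
  lam * mgf (2 * s) - s ^+ 2 * C2 * mgf (2 * s).
  by field; rewrite gt_eqF.
by rewrite lerBlDr -lerBlDl -mulrBr.
Qed.

Lemma ln_mgf_double (s : R) : 0 <= s -> s ^+ 2 * (C2 / lam) < 1 ->
  ln (mgf (2 * s)) <= - ln (1 - s ^+ 2 * (C2 / lam)) + 2 * ln (mgf s).
Proof.
move=> s0 s1; have h : 0 < 1 - s ^+ 2 * (C2 / lam) by rewrite subr_gt0.
have m2 := mgf_gt0 (2 * s); have m1 := mgf_gt0 s.
rewrite addrC lerBrDr -lnM ?posrE // (mulr_natl (ln _)) -lnXn //.
by rewrite ler_ln ?posrE ?mulr_gt0 ?exprn_gt0 // mgf_double.
Qed.

(** [ln_mgf_double] is applied at $s/2^k$: squaring the argument yields $4^{-k}$, and the factor 2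
    in front of [ln (mgf s)] accumulates to $2^k$. *)
Lemma ln_mgf_iter (s : R) K : 0 <= s -> s ^+ 2 * (C2 / lam) < 1 ->
  ln (mgf (2 * s)) <=
    \sum_(0 <= k < K) 2 ^+ k * - ln (1 - s ^+ 2 * (C2 / lam) * 4 ^- k)
    + 2 ^+ K * ln (mgf (2 * s / 2 ^+ K)).
Proof.
move=> s0 s1; elim: K => [|K IH].
  by rewrite big_geq // expr0 add0r divr1 mul1r.
apply: (le_trans IH); rewrite big_nat_recr //= -addrA lerD2l.
have p : 0 < 2 ^+ K :> R by rewrite exprn_gt0.
have e : s ^+ 2 * (C2 / lam) * 4 ^- K = (s / 2 ^+ K) ^+ 2 * (C2 / lam).
  have -> : 4 = 2 ^+ 2 :> R by rewrite -natrX.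
  by rewrite -exprM mulnC exprM; field; rewrite !gt_eqF.
have hs : 0 <= s / 2 ^+ K by rewrite divr_ge0 // ltW.
rewrite (exprSr 2 K) -[2 ^+ K * 2 * ln _]mulrA -mulrDr ler_pM2l // e.
have -> : 2 * s / (2 ^+ K * 2) = s / 2 ^+ K by field; rewrite gt_eqF.
rewrite -mulrA; apply: ln_mgf_double => //.
rewrite -e; apply: le_lt_trans s1; rewrite ler_piMr //.
  by rewrite mulr_ge0 ?sqr_ge0 ?divr_ge0 // ltW.
by rewrite invf_le1 ?exprn_gt0 // exprn_ege1 // ler1n.
Qed.

Hypothesis f_mean : mass_mean mu f = 0.

(** For a centered [f] the first-order term of [mgf] vanishes, so [ln (mgf q)] is at most of order
    $q^2$; at $q=r/2^K$ this beats the factor $2^K$. *)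
Lemma ln_mgf_scale_le (r : R) : 0 <= r ->
  exists V : R, forall K, 2 ^+ K * ln (mgf (r / 2 ^+ K)) <= V / 2 ^+ K.
Proof.
(* This is the second-order remainder with its exponential taken at $r$ instead of $r/2^K$, hence
   independent of $K$. *)
move=> r0; exists (\sum_x mu x * ((r * f x) ^+ 2 * expR (r * `|f x|))) => K.
have p : 0 < 2 ^+ K :> R by rewrite exprn_gt0.
set q := r / 2 ^+ K; have q0 : 0 <= q by rewrite divr_ge0 // ltW.
have q_le : q <= r by rewrite ler_pdivrMr // ler_peMr // exprn_ege1 // ler1n.
rewrite mulrC -ler_pdivlMr //.
have -> : ln (mgf q) = ln (1 + (mgf q - 1)) by rewrite addrC subrK.
apply: le_trans (le_ln1Dx _) _.
  by have := mgf_gt0 q; lra.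
have -> : mgf q - 1 = \sum_x mu x * (expR (q * f x) - (1 + q * f x)).
  transitivity (\sum_x (mu x * expR (q * f x) - mu x - q * (mu x * f x))).
    by rewrite !sumrB -mulr_sumr sum_mu -/(mass_mean mu f) f_mean mulr0 subr0.
  by apply: eq_bigr => x _; ring.
rewrite -mulrA mulr_suml; apply: ler_sum => x _.
have -> : mu x * ((r * f x) ^+ 2 * expR (r * `|f x|)) * ((2 ^+ K)^-1 / 2 ^+ K) =
    mu x * ((q * f x) ^+ 2 * expR (r * `|f x|)).
  by rewrite /q; field; rewrite gt_eqF.
rewrite ler_wpM2l // lerBlDl; apply: (le_trans (expR_quad_le _)).
rewrite lerD2l ler_wpM2l ?sqr_ge0 // ler_expR normrM (ger0_norm q0).
by rewrite ler_wpM2r.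
Qed.

End Concentration.

(** * The series $\varkappa$ and the quadratic equation of $\varphi$ *)

Section Constants.
Variable R : realType.

Let term (k : nat) : R := 2 ^+ k * ln (1 / (1 - 4 ^- k)).

Lemma exprV4_le (k : nat) : (0 < k)%N -> (4 ^- k : R) <= 4^-1.
Proof.
move=> k0; rewrite lef_pV2 ?posrE ?exprn_gt0 //.
by rewrite -{1}(expr1 4) ler_weXn2l // ler1n.
Qed.

Lemma varkappa_term_ge0 (k : nat) : (0 < k)%N -> 0 <= term k.
Proof.
move=> k0; rewrite mulr_ge0 ?exprn_ge0 // ln_ge0 // div1r.
have := exprV4_le k0; have : 0 < (4 ^- k : R) by rewrite invr_gt0 exprn_gt0.
by move=> h1 h2; rewrite invf_ge1; lra.
Qed.

(** With $w=4^{-k}\le 1/4$, $\ln\frac1{1-w}\le\frac w{1-w}\le 2w$; multiplying by $2^k$ leaves a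
    geometric majorant. *)
Lemma varkappa_term_le (k : nat) : (0 < k)%N -> term k <= 2 * 2 ^- k.
Proof.
move=> k0; have h2 := exprV4_le k0.
have h1 : 0 < (4 ^- k : R) by rewrite invr_gt0 exprn_gt0.
have p : 0 < 2 ^+ k :> R by rewrite exprn_gt0.
have e4 : 4 ^- k = 2 ^- k * 2 ^- k :> R.
  by rewrite -invfM -exprMn -natrM.
have -> : 2 * 2 ^- k = 2 ^+ k * (2 * 4 ^- k) :> R.
  by rewrite e4; field; rewrite gt_eqF.
rewrite ler_pM2l //; set w := 4 ^- k in h1 h2 *.
have -> : 1 / (1 - w) = 1 + w / (1 - w) by field; lra.
have w0 : 0 <= w / (1 - w) by rewrite divr_ge0; lra.
apply: (le_trans (le_ln1Dx _)); first by lra.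
by rewrite ler_pdivrMr; [nra|lra].
Qed.

(** The limit dominates the partial sums because they increase and converge; convergence comes from
    the geometric majorant. *)
Lemma varkappa_partial_le (K : nat) :
  \sum_(1 <= k < K) 2 ^+ k * ln (1 / (1 - 4 ^- k)) <= varkappa R.
Proof.
pose S (K : nat) : R := \sum_(1 <= k < K) term k.
have S_nd : nondecreasing_seq S.
  apply/nondecreasing_seqP => -[|k]; first by rewrite /S !big_geq.
  by rewrite /S (big_nat_recr k.+1) //= lerDl varkappa_term_ge0.
(* [S k.+1] runs over $1\le j\le k$, and $\sum_{j=1}^k 2\cdot 2^{-j}=2-2\cdot 2^{-k}$. *)
have S_ub k : S k.+1 <= 2 - 2 * 2 ^- k.
  elim: k => [|k IH]; first by rewrite /S big_geq // expr0; lra.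
  rewrite /S (big_nat_recr k.+1) //= -/(S k.+1).
  have := varkappa_term_le (ltn0Sn k).
  by move: IH; rewrite [2 ^+ k.+1]exprS !invfM; lra.
have S_cvg : cvgn S.
  apply: nondecreasing_is_cvgn => //; exists 2 => _ [k _ <-].
  apply: (le_trans (S_nd _ _ (leqnSn k))); apply: (le_trans (S_ub k)).
  by rewrite gerBl mulr_ge0 // invr_ge0 exprn_ge0.
exact: (nondecreasing_cvgn_le S_nd S_cvg K).
Qed.

Lemma varkappa_ge0 : 0 <= varkappa R.
Proof. by have := varkappa_partial_le 0; rewrite big_geq. Qed.

(** $\varphi(c)$ is the positive root of $u^2+\frac2c u=1$, the critical point equation of
    $-\ln(1-u^2)-cu$. *)
Lemma varphiP (c : R) : 0 < c ->
  [/\ 0 < varphi c, varphi c < 1 & 1 - varphi c ^+ 2 = 2 / c * varphi c].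
Proof.
move=> c0; rewrite /varphi; set q := Num.sqrt _.
have i0 : 0 < 1 / c by rewrite divr_gt0.
have q2 : q ^+ 2 = 1 + (1 / c) ^+ 2.
  by rewrite expr_div_n expr1n sqr_sqrtr // addr_ge0 // divr_ge0 // sqr_ge0.
have q0 : 0 <= q := sqrtr_ge0 _.
have -> : 2 / c = 2 * (1 / c) by rewrite div1r.
set i := 1 / c in i0 q2 *.
split; [nra|nra|].
by move: q2; rewrite !expr2; nra.
Qed.

End Constants.

(** The limit $K\to\infty$: if $A>B$, some $K>V/(A-B)$ satisfies $2^K>K$ and contradicts the
    hypothesis. *)
Lemma le_add_geometric (R : realType) (A B V : R) :
  (forall K : nat, A <= B + V / 2 ^+ K) -> A <= B.
Proof.
move=> h; rewrite leNgt; apply/negP => BA.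
have V0 : 0 < V by have := h 0%N; rewrite expr0 divr1; lra.
have d0 : 0 < A - B by rewrite subr_gt0.
pose K := (Num.trunc (V / (A - B))).+1.
have hK : V / (A - B) < K%:R.
  by have := truncnS_gt (V / (A - B)).
have p : 0 < 2 ^+ K :> R by rewrite exprn_gt0.
have : V / (A - B) < 2 ^+ K.
  by apply: (lt_le_trans hK); rewrite -natrX ler_nat ltnW // ltn_expl.
rewrite ltr_pdivrMr // => h1; have := h K.
have : V / 2 ^+ K < A - B by rewrite ltr_pdivrMr // mulrC.
lra.
Qed.

(** * Chernoff bound from the spectral gap *)

Section Deviation.
Variables (R : realType) (T : finType) (mu : T -> R) (P : T -> T -> R).
Hypothesis mu_prob : prob_mass mu.
Hypothesis P_ge0 : forall x y, 0 <= P x y.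
Hypothesis P_rev : forall x y, mu x * P x y = mu y * P y x.
Variables (C2 lam : R).
Hypothesis C2_gt0 : 0 < C2.
Hypothesis lam_gt0 : 0 < lam.
Hypothesis lam_gap : lam <= spectral_gap mu P.
Implicit Type f : T -> R.

(** The term $k=0$ of the iterated bound is kept; in the others $s^2C_2/\lambda<1$ is replaced by 1,
    which produces the terms of $\varkappa$. *)
Lemma ln_mgf_le f (s : R) :
  (forall x, \sum_y P x y * Num.max 0 (f x - f y) ^+ 2 <= C2) ->
  mass_mean mu f = 0 -> 0 <= s -> s ^+ 2 * (C2 / lam) < 1 ->
  ln (mgf mu f (2 * s)) <= varkappa R - ln (1 - s ^+ 2 * (C2 / lam)).
Proof.
move=> f_lip f_mean s0 s1.
have [V hV] := ln_mgf_scale_le mu_prob f_mean (mulr_ge0 (ler0n R 2) s0).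
(* Iterating [K.+1] times makes the term $k=0$ available; the remainder is then
   $V/2^{K+1}=(V/2)/2^K$. *)
apply: (@le_add_geometric _ _ _ (V / 2)) => K.
apply: (le_trans (ln_mgf_iter mu_prob P_ge0 P_rev (ltW C2_gt0) f_lip lam_gt0
  lam_gap K.+1 s0 s1)).
apply: lerD; last first.
  by apply: le_trans (hV K.+1) _; rewrite (exprS 2 K) invfM mulrA.
set u2 := s ^+ 2 * (C2 / lam) in s1 *.
have u0 : 0 <= u2 by rewrite mulr_ge0 ?sqr_ge0 // divr_ge0 // ltW.
rewrite big_ltn // expr0 invr1 mulr1 mul1r addrC lerD2r.
apply: le_trans (varkappa_partial_le R K.+1).
apply: ler_sum_nat => k /andP[k1 _]; rewrite ler_wpM2l ?exprn_ge0 //.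
have h1 : 0 < (4 ^- k : R) by rewrite invr_gt0 exprn_gt0.
have h2 := exprV4_le R k1.
rewrite div1r lnV ?posrE; last by lra.
by rewrite lerN2 ler_ln ?posrE; nra.
Qed.

Lemma upper_deviation_centered f (b : R) :
  (forall x, \sum_y P x y * Num.max 0 (f x - f y) ^+ 2 <= C2) ->
  mass_mean mu f = 0 -> 0 <= b ->
  (lne (upper_deviation mu f b)%:E <=
   (varkappa R - vartheta (2 * b * Num.sqrt (lam / C2)))%:E)%E.
Proof.
move=> f_lip f_mean b0; have [mu_ge0 sum_mu] := mu_prob.
set D := upper_deviation mu f b.
have D0 : 0 <= D by apply: sumr_ge0.
have D1 : D <= 1.
  rewrite -sum_mu [leRHS](bigID (fun x => b <= f x - mass_mean mu f)) /= lerDl.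
  exact: sumr_ge0.
have [Dle|Dgt] := leP D 0; first by rewrite le0_lneNy ?leNye.
rewrite lne_EFin // lee_fin.
have r0 : 0 < Num.sqrt (lam / C2) by rewrite sqrtr_gt0 divr_gt0.
set c := 2 * b * _.
(* At $c=0$, where $\vartheta$ is 0, it suffices that $D\le 1$ and $\varkappa\ge 0$. *)
rewrite /vartheta; case: eqP => [_|/eqP c_neq0].
  by rewrite subr0; apply: le_trans (ln_le0 D1) (varkappa_ge0 R).
have c0 : 0 < c.
  by rewrite lt_neqAle eq_sym c_neq0 /= mulr_ge0 ?(ltW r0) // mulr_ge0.
have [u0 u1 uE] := varphiP c0.
set u := varphi c in u0 u1 uE *.
(* Chosen so that $s^2C_2/\lambda=u^2$ and $2sb=cu$. *)
pose s := u * Num.sqrt (lam / C2).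
have s0 : 0 <= s by rewrite mulr_ge0 ?ltW.
have sE : s ^+ 2 * (C2 / lam) = u ^+ 2.
  rewrite exprMn sqr_sqrtr ?divr_ge0 ?ltW //.
  by field; rewrite !gt_eqF.
have s1 : s ^+ 2 * (C2 / lam) < 1 by rewrite sE expr_lt1 // ltW.
have := ln_mgf_le f_lip f_mean s0 s1; rewrite sE uE => h.
(* Markov's inequality: $e^{2s(f-b)}$ is at least 1 on the event and nonnegative elsewhere. *)
have : D <= mgf mu f (2 * s) * expR (- (c * u)).
  rewrite /D /upper_deviation big_mkcond /mgf mulr_suml.
  apply: ler_sum => x _; rewrite f_mean subr0 -mulrA -expRD.
  case: ifP => bf; last by rewrite mulr_ge0 ?expR_ge0.
  rewrite ler_peMr // -[leLHS]expR0 ler_expR.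
  have -> : 2 * s * f x + - (c * u) = 2 * s * (f x - b) by rewrite /s /c; ring.
  by apply: mulr_ge0; [apply: mulr_ge0|rewrite subr_ge0].
have m0 := mgf_gt0 mu_prob f (2 * s).
rewrite -ler_ln ?posrE ?mulr_gt0 ?expR_gt0 //.
rewrite lnM ?posrE ?expR_gt0 // expRK; lra.
Qed.

Lemma upper_deviation_le f (b : R) :
  (forall x, \sum_y P x y * Num.max 0 (f x - f y) ^+ 2 <= C2) -> 0 <= b ->
  (lne (upper_deviation mu f b)%:E <=
   (varkappa R - vartheta (2 * b * Num.sqrt (lam / C2)))%:E)%E.
Proof.
move=> f_lip b0; have [_ sum_mu] := mu_prob.
pose g x := f x - mass_mean mu f.
have g_mean : mass_mean mu g = 0.
  rewrite /mass_mean /g; under eq_bigr do rewrite mulrBr.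
  by rewrite sumrB -mulr_suml sum_mu mul1r subrr.
have -> : upper_deviation mu f b = upper_deviation mu g b.
  by rewrite /upper_deviation g_mean; apply: eq_bigl => x; rewrite subr0.
apply: upper_deviation_centered => // x.
have gB y : g x - g y = f x - f y by rewrite /g; ring.
by under eq_bigr do rewrite gB.
Qed.

End Deviation.

(** * Glauber dynamics of the path measure *)

Section Glauber.
Variables (R : realType) (N n : nat).
Local Notation Y := 'I_N.+1.
Local Notation X := {ffun 'I_n.+1 -> 'I_N.+1}.
Variables (nu : Y -> R) (Q : 'M[R]_N.+1).
Implicit Types (x y : X) (t : 'I_n.+1) (z : Y).

Definition resample x t z : X := [ffun s => if s == t then z else x s].

Lemma resampleE x t z : resample x t z t = z.
Proof. by rewrite ffunE eqxx. Qed.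

Lemma resampleD x t z s : s != t -> resample x t z s = x s.
Proof. by move=> st; rewrite ffunE (negbTE st). Qed.

(** Exchanging [x t] with the spare value [z] permutes the pairs [(x, z)] and turns the summand into
    [F x], whatever [z]. *)
Lemma sum_resample t (F : X -> R) :
  \sum_x \sum_z F (resample x t z) = N.+1%:R * \sum_x F x.
Proof.
rewrite (pair_bigA _ (fun x z => F (resample x t z))) /=.
rewrite (reindex_inj (h := fun p : X * Y => (resample p.1 t p.2, p.1 t))) /=.
  rewrite -(pair_bigA _ (fun x z => F (resample (resample x t z) t (x t)))) /=.
  rewrite mulr_sumr; apply: eq_bigr => x _.
  rewrite (eq_bigr (fun=> F x)) ?sumr_const ?card_ord ?mulr_natl // => z _.
  congr F; apply/ffunP => s; rewrite !ffunE.
  by case: eqP => // ->.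
move=> [x z] [x' z'] /= [/ffunP e1 e2]; congr (_, _); last first.
  by have := e1 t; rewrite !resampleE.
apply/ffunP => s; have := e1 s; rewrite !ffunE.
by case: eqP => // ->.
Qed.

(* Replacing the transitions by uniform ones, from the last to the first, keeps
   the total mass and ends at a product measure. *)
Lemma path_measure_sum :
  \sum_z nu z = 1 -> (forall z, \sum_z' Q z z' = 1) ->
  \sum_(x : X) path_measure nu Q x = 1.
Proof.
move=> nu1 Q1.
pose h j (x : X) : R := nu (x ord0) * \prod_(s < n)
  (if (s < j)%N then Q (x (inord s)) (x (inord s.+1)) else N.+1%:R^-1).
have -> : \sum_(x : X) path_measure nu Q x = \sum_(x : X) h n x.
  apply: eq_bigr => x _; congr (_ * _); apply: eq_bigr => s _.
  by rewrite ltn_ord.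
have N0 : N.+1%:R != 0 :> R by rewrite pnatr_eq0.
suff : forall j, (j <= n)%N -> \sum_(x : X) h j x = 1 by apply.
elim=> [_|j IH jn].
  pose F (t : 'I_n.+1) z := if t == ord0 then nu z else N.+1%:R^-1.
  transitivity (\sum_(x : X) \prod_t F t (x t)).
    by apply: eq_bigr => x _; rewrite big_ord_recl.
  rewrite -(bigA_distr_bigA F); apply: big1 => t _; rewrite /F.
  by case: eqP => // _; rewrite sumr_const card_ord -[_ *+ _]mulr_natl divff.
rewrite -(IH (ltnW jn)); apply: (mulfI N0).
(* Coordinate $j+1$ enters [h j.+1] only as the target of transition $j$, the later factors being
   constant; summing it out leaves a row sum of [Q]. *)
rewrite -(sum_resample (inord j.+1)) mulr_sumr; apply: eq_bigr => x _.
have neq k : (k <= j)%N -> inord k != inord j.+1 :> 'I_n.+1.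
  move=> kj; rewrite -val_eqE /= !inordK ?ltnS ?(leq_trans kj (ltnW jn)) //.
  by rewrite neq_ltn ltnS kj.
pose G := nu (x ord0) * \prod_(s < n | s != Ordinal jn)
  (if (s < j)%N then Q (x (inord s)) (x (inord s.+1)) else N.+1%:R^-1).
have -> : h j x = G * N.+1%:R^-1.
  by rewrite /h (bigD1 (Ordinal jn)) //= ltnn mulrCA mulrC.
transitivity (\sum_z G * Q (x (inord j)) z); last first.
  by rewrite -mulr_sumr Q1 mulr1 mulrCA mulrV ?unitfE ?mulr1.
apply: eq_bigr => z _; rewrite /h (bigD1 (Ordinal jn)) //= ltnSn.
rewrite resampleE (resampleD _ _ (neq j _)) // -(mulrC (\prod_(_ < n | _) _)) mulrA.
congr (_ * _ * _).
  by rewrite resampleD // -(inord_val ord0) neq.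
apply: eq_bigr => s; rewrite -val_eqE /= => sj.
rewrite ltnS leq_eqVlt (negbTE sj) /=; case: ifP => // sltj.
by rewrite !resampleD // neq // ltnW.
Qed.

(** Coordinate [t] meets transition [t], absent at the last time, and transition [t.-1], absent at
    the first. *)
Lemma prod_split_neighbours t (G : nat -> R) :
  \prod_(s < n) G s =
  (if (t < n)%N then G t else 1) * (if (0 < t)%N then G t.-1 else 1) *
  \prod_(s < n | (s != t :> nat) && (s.+1 != t)) G s.
Proof.
rewrite (bigID (fun s : 'I_n => s == t :> nat)) /= -mulrA; congr (_ * _).
  case: ifPn => [tn|tn].
    by rewrite (big_pred1 (Ordinal tn)).
  by apply: big_pred0 => s; apply: contraNF tn => /eqP <-.
rewrite (bigID (fun s : 'I_n => s.+1 == t :> nat)) /=; congr (_ * _).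
case: ifPn => [t0|t0]; last first.
  by apply: big_pred0 => s; rewrite [_.+1 == _](contraNF _ t0) ?andbF // => /eqP <-.
have tn : (t.-1 < n)%N by rewrite -ltnS prednK.
rewrite (big_pred1 (Ordinal tn)) // => s; rewrite /= -val_eqE /=.
by case: (t : nat) t0 => // k _; rewrite eqSS /=;
  case: (eqVneq (s : nat) k) => [->|]; rewrite ?andbF // andbT neq_ltn ltnSn.
Qed.

Hypothesis n_gt0 : (0 < n)%N.

Definition glauber_weight t x z : R :=
  if t == ord0 then nu z * Q z (x (inord 1))
  else if t == ord_max then Q (x (inord n.-1)) z
  else Q (x (inord t.-1)) z * Q z (x (inord t.+1)).

(* The factors of the path measure that do not involve the coordinate t. *)
Definition path_rest t x : R :=
  (if t == ord0 then 1 else nu (x ord0)) *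
  \prod_(s < n | (s != t :> nat) && (s.+1 != t)) Q (x (inord s)) (x (inord s.+1)).

(** As [path_rest] does not see [x t], the conditional law of [x t] given the other coordinates is
    proportional to [glauber_weight]; detailed balance rests on this. *)
Lemma path_measure_split t x :
  path_measure nu Q x = path_rest t x * glauber_weight t x (x t).
Proof.
rewrite /path_measure /path_rest /glauber_weight.
rewrite (prod_split_neighbours t (fun s => Q (x (inord s)) (x (inord s.+1)))).
set p := \prod_(_ < n | _) _.
have [->|t_neq0] := eqVneq t ord0.
  rewrite /= n_gt0 -[inord 0](_ : ord0 = _); first by ring.
  by apply: val_inj; rewrite /= inordK.
have t0 : (0 < t)%N by rewrite lt0n.
have [->|t_neqn] := eqVneq t ord_max.
  rewrite /= ltnn n_gt0 prednK //.
  have -> : inord n = ord_max :> 'I_n.+1 by apply: val_inj; rewrite /= inordK.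
  by ring.
have tn : (t < n)%N by rewrite ltn_neqAle -ltnS ltn_ord andbT.
by rewrite t0 tn prednK // inord_val; ring.
Qed.

Lemma glauber_weight_off t x y z :
  (forall s, s != t -> x s = y s) -> glauber_weight t x z = glauber_weight t y z.
Proof.
move=> xy; rewrite /glauber_weight.
have xyn k : (k <= n)%N -> k != t -> x (inord k) = y (inord k).
  by move=> kn kt; apply: xy; rewrite -val_eqE /= inordK.
case: eqP => [t0|/eqP t0]; first by rewrite xyn // t0.
have t0' : (0 < t)%N by rewrite lt0n.
case: eqP => [tn|/eqP tn].
  by rewrite xyn ?leq_pred // tn /= neq_ltn prednK // leqnn.
have tn' : (t < n)%N by rewrite ltn_neqAle -ltnS ltn_ord andbT.
rewrite !xyn //; first by rewrite neq_ltn ltnSn orbT.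
  by rewrite (leq_trans (leq_pred _)) // ltnW.
by rewrite neq_ltn prednK // leqnn.
Qed.

Lemma path_rest_off t x y :
  (forall s, s != t -> x s = y s) -> path_rest t x = path_rest t y.
Proof.
move=> xy; rewrite /path_rest; congr (_ * _).
  by case: eqP => // /eqP t0; rewrite xy // eq_sym.
apply: eq_bigr => s /andP[st st']; congr (Q _ _); apply: xy;
  by rewrite -val_eqE /= inordK // ltnS ?ltn_ord // ltnW.
Qed.

Hypothesis Q_markov : markov_matrix Q.
Hypothesis nu_prob : prob_mass nu.
Hypothesis mu_pos : forall x : X, 0 < path_measure nu Q x.

Lemma path_measure_prob : prob_mass (path_measure (n := n) nu Q).
Proof.
split; first by move=> x; exact: ltW.
by apply: path_measure_sum; [case: nu_prob|case: Q_markov].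
Qed.

Lemma glauber_weight_ge0 t x z : 0 <= glauber_weight t x z.
Proof.
have [nu0 _] := nu_prob; have [Q0 _] := Q_markov.
by rewrite /glauber_weight; do 2?case: ifP => _; rewrite ?mulr_ge0.
Qed.

(** By [path_measure_split], the weight of the current value [x t] is a factor of the positive mass
    of [x]. *)
Lemma glauber_weight_sum_gt0 t x : 0 < \sum_z glauber_weight t x z.
Proof.
rewrite (bigD1 (x t)) //= ltr_pwDl //; last first.
  by apply: sumr_ge0 => z _; exact: glauber_weight_ge0.
have := mu_pos x; rewrite (path_measure_split t) lt_neqAle eq_sym mulf_eq0 negb_or.
by move=> /andP[/andP[_ w] _]; rewrite lt_neqAle eq_sym w glauber_weight_ge0.
Qed.

Lemma prod_delta_off t x y :
  \prod_(s < n.+1 | s != t) (x s == y s)%:R = (y == resample x t (y t))%:R :> R.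
Proof.
have [e|ne] := eqVneq y (resample x t (y t)).
  by apply: big1 => s st; rewrite e resampleD ?eqxx.
have [s st xy] : exists2 s, s != t & x s != y s.
  apply/exists_inP; rewrite -negb_forall_in; apply: contra ne => /forall_inP h.
  apply/eqP/ffunP => s; rewrite ffunE; case: eqP => [->//|/eqP st].
  by apply/esym/eqP/h.
by rewrite (bigD1 s) //= (negbTE xy) mul0r.
Qed.

(** At the last time the normalization is a row sum of [Q], that is 1, so one formula covers all
    three cases. *)
Lemma glauber_atE t x y :
  glauber_at nu Q t x y = glauber_weight t x (y t) / (\sum_z glauber_weight t x z)
    * (y == resample x t (y t))%:R.
Proof.
rewrite -prod_delta_off /glauber_at /glauber_weight; congr (_ * _).
have [Q0 Q1] := Q_markov.
have [->//|t0] := eqVneq t ord0.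
have [->|tn //] := eqVneq t ord_max.
by rewrite Q1 divr1.
Qed.

Lemma glauber_at_sum t x (h : X -> R) :
  \sum_y glauber_at nu Q t x y * h y =
  \sum_z glauber_weight t x z / (\sum_z glauber_weight t x z) * h (resample x t z).
Proof.
set D := \sum_z glauber_weight t x z.
transitivity (\sum_(y : X) \sum_z (if z == y t then
   glauber_weight t x z / D * (y == resample x t z)%:R * h y else 0)).
  apply: eq_bigr => y _; rewrite -big_mkcond (big_pred1 (y t)) //.
  by rewrite glauber_atE.
rewrite exchange_big; apply: eq_bigr => z _ /=.
rewrite (bigD1 (resample x t z)) //= resampleE !eqxx mulr1 big1 ?addr0 //.
by move=> y /negbTE yx; case: ifP => // _; rewrite yx mulr0 mul0r.
Qed.

Lemma glauber_at_ge0 t x y : 0 <= glauber_at nu Q t x y.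
Proof.
rewrite glauber_atE mulr_ge0 // divr_ge0 ?glauber_weight_ge0 //.
exact: ltW (glauber_weight_sum_gt0 _ _).
Qed.

(** Unless [x] and [y] agree off [t], both sides vanish. If they agree, [path_rest] and the
    normalization coincide, and each side carries the product of the weights of [x t] and [y t]. *)
Lemma glauber_at_rev t x y :
  path_measure nu Q x * glauber_at nu Q t x y =
  path_measure nu Q y * glauber_at nu Q t y x.
Proof.
rewrite !glauber_atE -!prod_delta_off.
have -> : \prod_(s < n.+1 | s != t) (x s == y s)%:R =
          \prod_(s < n.+1 | s != t) (y s == x s)%:R :> R.
  by apply: eq_bigr => s _; rewrite eq_sym.
rewrite prod_delta_off; have [xy|] := eqVneq x _; last by rewrite !mulr0.
have off s : s != t -> x s = y s by move=> st; rewrite xy resampleD.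
rewrite !(path_measure_split t) (path_rest_off off).
rewrite !(glauber_weight_off _ off).
by under [X in _ / X]eq_bigr do rewrite (glauber_weight_off _ off); ring.
Qed.

Lemma glauber_ge0 x y : 0 <= glauber nu Q x y.
Proof.
by rewrite mulr_ge0 ?invr_ge0 // sumr_ge0 // => t _; exact: glauber_at_ge0.
Qed.

Lemma glauber_rev x y :
  path_measure nu Q x * glauber nu Q x y = path_measure nu Q y * glauber nu Q y x.
Proof.
rewrite /glauber !(mulrCA _ n.+1%:R^-1); congr (_ * _); rewrite !mulr_sumr.
by apply: eq_bigr => t _; exact: glauber_at_rev.
Qed.

(** The update at [t] averages over the [resample x t z] with weights of total 1, so a bound uniform
    in [z] survives it. *)
Lemma glauber_sum_le x (h : X -> R) (c : 'I_n.+1 -> R) :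
  (forall t z, h (resample x t z) <= c t) ->
  \sum_y glauber nu Q x y * h y <= n.+1%:R^-1 * \sum_t c t.
Proof.
move=> hc.
have -> : \sum_y glauber nu Q x y * h y =
  n.+1%:R^-1 * \sum_t \sum_y glauber_at nu Q t x y * h y.
  rewrite exchange_big mulr_sumr; apply: eq_bigr => y _.
  by rewrite /glauber -mulrA mulr_suml.
rewrite ler_wpM2l ?invr_ge0 //; apply: ler_sum => t _.
rewrite glauber_at_sum; have D0 := glauber_weight_sum_gt0 t x.
set D := \sum_z glauber_weight t x z in D0 *.
rewrite -[leRHS]mul1r -(divff (lt0r_neq0 D0)) {1}/D !mulr_suml.
apply: ler_sum => z _; apply: ler_wpM2l => //.
by rewrite divr_ge0 ?glauber_weight_ge0 // ltW.
Qed.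

End Glauber.

(** * The spectral power as a quadratic form *)

Section HalfProjection.
Variables (R : realType) (I : finType) (B : I -> I -> R).
Hypothesis B_sym : forall t s, B t s = B s t.
Hypothesis B_sq : forall s r, \sum_t B t s * B t r = 2^-1 * B s r.
Implicit Types v w : I -> R.

(* As B is symmetric with B ^ 2 = B / 2, it is half an orthogonal projection. *)
Let app v t : R := \sum_s B t s * v s.

Definition quad_form v : R := \sum_t app v t * v t.

(** In matrix form this is $B=2B^{T}B$. *)
Lemma app_dot v w : \sum_t app v t * w t = 2 * \sum_t app v t * app w t.
Proof.
have -> : \sum_t app v t * app w t =
    \sum_s \sum_r (\sum_t B t s * B t r) * (v s * w r).
  under [RHS]eq_bigr => s _ do under eq_bigr => r _ do rewrite mulr_suml.
  under [RHS]eq_bigr => s _ do rewrite exchange_big.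
  rewrite [RHS]exchange_big; apply: eq_bigr => t _ /=.
  rewrite /app mulr_suml; apply: eq_bigr => s _.
  by rewrite mulr_sumr; apply: eq_bigr => r _; ring.
rewrite exchange_big mulr_sumr; apply: eq_bigr => r _ /=.
rewrite /app mulr_suml mulr_sumr; apply: eq_bigr => s _.
by rewrite B_sq (B_sym r s); field.
Qed.

(** Tangent inequality of a convex form: the two sides differ by exactly $2|Bv-Bw|^2$. *)
Lemma quad_form_sub_le v w :
  quad_form v - quad_form w <= 2 * \sum_t app v t * (v t - w t).
Proof.
have -> : \sum_t app v t * (v t - w t) = quad_form v - \sum_t app v t * w t.
  by rewrite -sumrB; apply: eq_bigr => t _; ring.
rewrite /quad_form (app_dot v v) (app_dot w w) (app_dot v w).
have : 0 <= \sum_t (app v t - app w t) ^+ 2 by apply: sumr_ge0 => t _; exact: sqr_ge0.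
have -> : \sum_t (app v t - app w t) ^+ 2 = \sum_t app v t * app v t
    - 2 * (\sum_t app v t * app w t) + \sum_t app w t * app w t.
  by rewrite mulr_sumr -sumrB -big_split; apply: eq_bigr => t _ /=; ring.
lra.
Qed.

(** Because $\langle Bv,v\rangle=2|Bv|^2$, one has $0\le|v/2-Bv|^2=|v|^2/4-|Bv|^2$. *)
Lemma app_sqr_le v : \sum_t app v t ^+ 2 <= 4^-1 * \sum_t v t ^+ 2.
Proof.
have : 0 <= \sum_t (2^-1 * v t - app v t) ^+ 2.
  by apply: sumr_ge0 => t _; exact: sqr_ge0.
have -> : \sum_t (2^-1 * v t - app v t) ^+ 2 =
    4^-1 * (\sum_t v t ^+ 2) - \sum_t app v t * v t + \sum_t app v t ^+ 2.
  by rewrite mulr_sumr -sumrB -big_split; apply: eq_bigr => t _ /=; field.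
rewrite app_dot; under [X in _ - 2 * X]eq_bigr do rewrite -expr2.
lra.
Qed.

Lemma quad_form_resample (r : R) v : 0 <= r -> (forall t, `|v t| <= r) ->
  exists c : I -> R, \sum_t c t <= 4 * r ^+ 4 * #|I|%:R /\
    forall t w, `|w t| <= r -> (forall s, s != t -> w s = v s) ->
      Num.max 0 (quad_form v - quad_form w) ^+ 2 <= c t.
Proof.
(* A change of coordinate $t$ by at most $2r$ costs at most $2|(Bv)_t|\cdot 2r$, whose square this
   is. Summed over $t$ it is controlled by $|Bv|^2$. *)
move=> r0 vr; exists (fun t => 16 * r ^+ 2 * app v t ^+ 2); split.
  rewrite -mulr_sumr.
  have v2 : \sum_t v t ^+ 2 <= r ^+ 2 * #|I|%:R.
    rewrite mulr_natr -sumr_const; apply: ler_sum => t _.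
    by rewrite -(real_normK (num_real (v t))) lerXn2r ?nnegrE.
  have := app_sqr_le v; set S := \sum_t _; set W := \sum_t _ in v2 * => h.
  have r2 := sqr_ge0 r.
  apply: (@le_trans _ _ (16 * r ^+ 2 * (4^-1 * (r ^+ 2 * #|I|%:R)))).
    apply: ler_wpM2l; first by rewrite mulr_ge0.
    by apply: (le_trans h); rewrite ler_wpM2l.
  by rewrite le_eqVlt; apply/orP; left; apply/eqP; field.
move=> t w wr wv.
have d := quad_form_sub_le v w.
have e : \sum_s app v s * (v s - w s) = app v t * (v t - w t).
  rewrite (bigD1 t) //= big1 ?addr0 // => s st.
  by rewrite wv // subrr mulr0.
rewrite e in d.
have h1 : `|v t - w t| <= 2 * r.
  by apply: (le_trans (ler_normB _ _)); rewrite mulr2n mulrDl mul1r lerD.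
have -> : 16 * r ^+ 2 * app v t ^+ 2 = (2 * `|app v t| * (2 * r)) ^+ 2.
  by rewrite !exprMn real_normK ?num_real //; ring.
apply: lerXn2r; rewrite ?nnegrE ?le_max ?lexx // ?mulr_ge0 ?mulr_ge0 //.
rewrite ge_max mulr_ge0 ?mulr_ge0 //=.
apply: (le_trans d); apply: (le_trans (ler_norm _)).
by rewrite !normrM normr_nat -mulrA ler_wpM2l // ler_wpM2l.
Qed.

End HalfProjection.

(** * Orthogonality of sampled cosines *)

Section Trigonometry.
Variable R : realType.

(* Multiplying by 2 * sin (pi * j / N) makes the sum telescope. *)
Lemma sum_cos_eq0 (N j : nat) (al : R) : (0 < j < N)%N ->
  \sum_(t < N) cos (2 * pi * j%:R * t%:R / N%:R + al) = 0.
Proof.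
move=> /andP[j0 jN]; have N0 : 0 < N%:R :> R by rewrite ltr0n (leq_trans _ jN).
pose h : R := pi * j%:R / N%:R.
have sh : 0 < sin h.
  apply: sin_gt0_pi; apply/andP; split.
    by rewrite divr_gt0 // mulr_gt0 ?pi_gt0 // ltr0n.
  by rewrite ltr_pdivrMr // ltr_pM2l ?pi_gt0 // ltr_nat.
apply: (mulfI (lt0r_neq0 (mulr_gt0 (ltr0Sn R 1) sh))).
rewrite mulr0 mulr_sumr.
pose F (t : nat) := sin (2 * h * t%:R + al - h).
transitivity (\sum_(0 <= t < N) (F t.+1 - F t)); last first.
  rewrite telescope_sumr //; apply/eqP; rewrite subr_eq0 /F mulr0 add0r.
  (* The two ends of the telescope differ by $2hN=2\pi j$, that is $j$ full periods. *)
  have -> : 2 * h * N%:R + al - h = al - h + pi *+ 2 *+ j.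
    by rewrite /h -(mulr_natr _ j) -(mulr_natr pi 2); field; rewrite gt_eqF.
  by rewrite (periodicn (@sinD2pi R)).
rewrite big_mkord; apply: eq_bigr => t _; rewrite /F.
set A := 2 * pi * j%:R * t%:R / N%:R + al.
have -> : 2 * h * t.+1%:R + al - h = A + h.
  by rewrite /A /h -natr1; field; rewrite gt_eqF.
have -> : 2 * h * t%:R + al - h = A - h.
  by rewrite /A /h; field; rewrite gt_eqF.
by rewrite sinD sinB; ring.
Qed.

Lemma cos_mul (A B : R) : cos A * cos B = 2^-1 * (cos (A + B) + cos (A - B)).
Proof. by rewrite cosD cosB; field. Qed.

(** By product-to-sum, the frequency $k+l$ lies strictly between 0 and $N$ and sums to zero; the
    frequency $k-l$ survives only when it is 0. *)
Lemma sum_cos_mul (N k l : nat) (s r : R) :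
  (0 < k)%N -> (0 < l)%N -> (k.*2 < N)%N -> (l.*2 < N)%N ->
  \sum_(t < N) cos (2 * pi * k%:R * (t%:R - s) / N%:R)
             * cos (2 * pi * l%:R * (t%:R - r) / N%:R) =
  if l == k then N%:R / 2 * cos (2 * pi * k%:R * (s - r) / N%:R) else 0.
Proof.
move=> k0 l0 kN lN.
have N0 : N%:R != 0 :> R by rewrite pnatr_eq0; case: N kN lN.
have kl : (0 < k + l < N)%N by rewrite addn_gt0 k0 /=; lia.
under eq_bigr do rewrite cos_mul.
rewrite -mulr_sumr big_split /=.
have -> : \sum_(t < N) cos (2 * pi * k%:R * (t%:R - s) / N%:R
             + 2 * pi * l%:R * (t%:R - r) / N%:R) = 0.
  rewrite -[RHS](sum_cos_eq0 (- (2 * pi * (k%:R * s + l%:R * r) / N%:R)) kl).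
  by apply: eq_bigr => t _; congr cos; rewrite natrD; field.
rewrite add0r; case: ltngtP => [lk|kl'|->].
- have jN : (0 < k - l < N)%N by lia.
  rewrite -[RHS](mulr0 2^-1); congr (_ * _).
  rewrite -[RHS](sum_cos_eq0 (- (2 * pi * (k%:R * s - l%:R * r) / N%:R)) jN).
  by apply: eq_bigr => t _; congr cos; rewrite natrB 1?ltnW //; field.
(* [sum_cos_eq0] takes a natural frequency, so the difference is reversed by parity of the
   cosine. *)
- have jN : (0 < l - k < N)%N by lia.
  rewrite -[RHS](mulr0 2^-1); congr (_ * _).
  rewrite -[RHS](sum_cos_eq0 (- (2 * pi * (l%:R * r - k%:R * s) / N%:R)) jN).
  apply: eq_bigr => t _; rewrite -cosN; congr cos.
  by rewrite natrB 1?ltnW //; field.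
- rewrite (eq_bigr (fun=> cos (2 * pi * k%:R * (s - r) / N%:R))).
    by rewrite sumr_const card_ord -mulr_natl; ring.
  move=> t _; rewrite -cosN; congr cos; by field.
Qed.

End Trigonometry.

(** * The band kernel and its Fourier side *)

Section Band.
Variables (R : realType) (m n : nat) (eps : R) (k1 k2 : nat).
Local Notation X := {ffun 'I_n.+1 -> 'I_(m.*2.+1)}.

(* Half the orthogonal projection onto the span of the cosines and sines with
   frequencies in [k1, k2]. *)
Definition band_kernel (t s : 'I_n.+1) : R := n.+1%:R^-1 *
  \sum_(k1 <= k < k2.+1) cos (2 * pi * k%:R * (t%:R - s%:R) / n.+1%:R).

Lemma band_kernel_sym t s : band_kernel t s = band_kernel s t.
Proof.
congr (_ * _); apply: eq_bigr => k _; rewrite -cosN; congr cos.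
by field.
Qed.

(** Orthogonality removes the pairs $k\ne l$; each diagonal pair gives $(n+1)/2$ times its cosine,
    whence the factor one half. *)
Lemma band_kernel_sq s r : (0 < k1)%N -> (k2.*2 < n.+1)%N ->
  \sum_t band_kernel t s * band_kernel t r = 2^-1 * band_kernel s r.
Proof.
move=> k1_gt0 k2_lt; pose c k (t s : 'I_n.+1) : R :=
  cos (2 * pi * k%:R * (t%:R - s%:R) / n.+1%:R).
have -> : \sum_t band_kernel t s * band_kernel t r = n.+1%:R^-1 ^+ 2 *
    \sum_(k1 <= k < k2.+1) \sum_(k1 <= l < k2.+1) \sum_t c k t s * c l t r.
  under [X in _ * X]eq_bigr => k _ do rewrite exchange_big.
  rewrite [X in _ * X]exchange_big mulr_sumr; apply: eq_bigr => t _ /=.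
  rewrite /band_kernel mulrACA -expr2; congr (_ * _).
  rewrite mulr_suml; apply: eq_bigr => k _; exact: mulr_sumr.
have -> : 2^-1 * band_kernel s r =
    n.+1%:R^-1 ^+ 2 * \sum_(k1 <= k < k2.+1) (n.+1%:R / 2 * c k s r).
  rewrite -mulr_sumr /band_kernel; set S := \sum_(_ <= _ < _) _.
  have : n.+1%:R != 0 :> R by rewrite pnatr_eq0.
  by move: n.+1%:R => N N0; field.
congr (_ * _); apply: eq_big_nat => k /andP[k1k kk2].
rewrite (eq_big_nat _ _ (F2 := fun l => if l == k then n.+1%:R / 2 * c k s r else 0)).
  by rewrite -big_mkcond big_nat1_eq k1k kk2.
by move=> l /andP[k1l lk2]; apply: sum_cos_mul; lia.
Qed.

Lemma sum_complex (I : finType) (F G : I -> R) :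
  \sum_i (F i +i* G i)%C = ((\sum_i F i) +i* (\sum_i G i))%C.
Proof.
by apply: (big_rec3 (fun u v z => z = (u +i* v)%C)) => // i u v z _ ->.
Qed.

(** Expanding real and imaginary parts, $|\sum_t e^{ib_t}v_t|^2=\sum_{t,s}\cos(b_s-b_t)v_tv_s$. *)
Lemma normc_fourier_sqr (x : X) k :
  ComplexField.Normc.normc (fourier eps x k) ^+ 2 = n.+1%:R^-1 *
  \sum_(t < n.+1) \sum_(s < n.+1) cos (2 * pi * k%:R * (t%:R - s%:R) / n.+1%:R)
    * (state eps (x t) * state eps (x s)).
Proof.
pose b (t : 'I_n.+1) : R := - (2 * pi * k%:R * t%:R / n.+1%:R).
have argE (t : 'I_n.+1) :
    (- 2 * (pi : R)%:C%C * 'i * k%:R * t%:R / n.+1%:R) = (0 +i* b t)%C :> R[i].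
  have -> : (0 +i* b t)%C = 'i%C * (b t)%:C%C :> R[i].
    by apply/eqP; rewrite eq_complex /= !(mul0r, mulr0, mul1r, subr0, add0r, oppr0) !eqxx.
  by rewrite /b rmorphN !rmorphM /= fmorphV !rmorph_nat complexiE; ring.
have termE (t : 'I_n.+1) :
    cexp (- 2 * (pi : R)%:C%C * 'i * k%:R * t%:R / n.+1%:R) * (state eps (x t))%:C%C
    = (cos (b t) * state eps (x t) +i* (sin (b t) * state eps (x t)))%C.
  rewrite argE /cexp /= expR0 mul1r.
  by apply/eqP; rewrite eq_complex /= !mulr0 subr0 add0r !eqxx.
rewrite /fourier (eq_bigr _ (fun t _ => termE t)) sum_complex.
rewrite ComplexField.Normc.normcM exprMn; congr (_ * _).
  rewrite /ComplexField.Normc.normc /= expr0n addr0 sqr_sqrtr ?sqr_ge0 //.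
  by rewrite exprVn sqr_sqrtr.
rewrite /ComplexField.Normc.normc sqr_sqrtr ?addr_ge0 ?sqr_ge0 //.
rewrite !expr2 !mulr_suml -big_split; apply: eq_bigr => t _ /=.
rewrite !mulr_sumr -big_split; apply: eq_bigr => s _ /=.
have -> : 2 * pi * k%:R * (t%:R - s%:R) / n.+1%:R = b s - b t by rewrite /b; ring.
by rewrite cosB; ring.
Qed.

Lemma spectral_powerE (x : X) : spectral_power eps k1 k2 x =
  n.+1%:R^-1 * quad_form band_kernel (fun t => state eps (x t)).
Proof.
rewrite /spectral_power; congr (_ * _).
under eq_bigr do rewrite normc_fourier_sqr.
rewrite -mulr_sumr exchange_big mulr_sumr; apply: eq_bigr => t _.
rewrite exchange_big mulr_suml mulr_sumr; apply: eq_bigr => s _ /=.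
by rewrite -mulr_suml /band_kernel; ring.
Qed.

Lemma state_norm_le (i : 'I_(m.*2.+1)) : 0 <= eps -> `|state eps i| <= m%:R * eps.
Proof.
move=> eps0; rewrite /state normrM (ger0_norm eps0) ler_wpM2r //.
have h : i%:R <= m%:R * 2 :> R by rewrite -natrM muln2 ler_nat -ltnS.
by have := ler0n R i; rewrite ler_norml => i0; apply/andP; split; lra.
Qed.

End Band.

(** * The deviation bound *)

(** Powers of $n+1$: the squared prefactor of the form gives $-2$, the Glauber average $-1$, and the
    sum over coordinates $+1$. *)
Lemma spectral_power_lip (R : realType) (m n k1 k2 : nat) (eps : R)
    (Q : 'M[R]_(m.*2.+1)) (nu : 'I_(m.*2.+1) -> R)
    (x : {ffun 'I_n.+1 -> 'I_(m.*2.+1)}) :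
  (0 < n)%N -> markov_matrix Q -> prob_mass nu ->
  (forall y : {ffun 'I_n.+1 -> 'I_(m.*2.+1)}, 0 < path_measure nu Q y) ->
  0 <= eps -> (0 < k1)%N -> (k2.*2 < n.+1)%N ->
  \sum_y glauber nu Q x y *
    Num.max 0 (spectral_power eps k1 k2 x - spectral_power eps k1 k2 y) ^+ 2
  <= 4 * (m%:R * eps) ^+ 4 / n.+1%:R ^+ 2.
Proof.
move=> n_gt0 Q_markov nu_prob mu_pos eps0 k1_gt0 k2_lt.
have N0 : 0 < n.+1%:R :> R by rewrite ltr0n.
have r0 : 0 <= m%:R * eps by rewrite mulr_ge0.
have v_le t : `|state eps (x t)| <= m%:R * eps by exact: state_norm_le.
have [c [c_sum c_ge]] := quad_form_resample (@band_kernel_sym R n k1 k2)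
  (fun s r => band_kernel_sq R s r k1_gt0 k2_lt) r0 v_le.
apply: (le_trans (glauber_sum_le n_gt0 Q_markov nu_prob mu_pos
  (c := fun t => n.+1%:R^-1 ^+ 2 * c t) _)).
  move=> t z; rewrite !spectral_powerE -mulrBr.
  rewrite -[X in Num.max X _](mulr0 n.+1%:R^-1) -maxr_pMr ?invr_ge0 // exprMn.
  rewrite ler_wpM2l ?sqr_ge0 //; apply: c_ge => [|s st].
    exact: state_norm_le.
  by rewrite resampleD.
rewrite -mulr_sumr mulrA.
move: c_sum; rewrite card_ord => c_sum.
apply: (@le_trans _ _ (n.+1%:R^-1 * n.+1%:R^-1 ^+ 2 * (4 * (m%:R * eps) ^+ 4 * n.+1%:R))).
  by apply: ler_wpM2l => //; rewrite mulr_ge0 ?sqr_ge0 ?invr_ge0.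
rewrite le_eqVlt; apply/orP; left; apply/eqP.
by move: n.+1%:R N0 => N N0; field; rewrite gt_eqF.
Qed.

Theorem corollary3p3 (R : realType) (m n : nat) (eps lambda1 : R)
    (Q : 'M[R]_(m.*2.+1)) (nu : 'I_(m.*2.+1) -> R) (k1 k2 : nat)
    (m_gt0 : (0 < m)%N) (eps_gt0 : 0 < eps)
    (Q_markov : markov_matrix Q)
    (Q_irreducible : irreducible_chain Q)
    (Q_aperiodic : aperiodic_chain Q)
    (nu_prob : prob_mass nu)
    (nu_reversible : reversible_chain nu Q)
    (n_gt0 : (0 < n)%N)
    (mu_pos : forall x : {ffun 'I_n.+1 -> 'I_(m.*2.+1)},
        0 < path_measure nu Q x)
    (lambda1_gt0 : 0 < lambda1)
    (gap_ge : lambda1 / n.+1%:R <=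
        spectral_gap (path_measure (n := n) nu Q) (glauber nu Q))
    (k1_gt0 : (0 < k1)%N) (k1_lt_k2 : (k1 < k2)%N)
    (k2_lt : k2%:R < n.+1%:R / 2 :> R)
    (a : R) (a_ge0 : 0 <= a) :
  (lne (upper_deviation (path_measure (n := n) nu Q)
          (spectral_power eps k1 k2) (a / Num.sqrt n.+1%:R))%:E
   <= (varkappa R
       - vartheta (a * (Num.sqrt lambda1 / (m%:R * eps) ^+ 2)))%:E)%E.
Proof.
have N0 : 0 < n.+1%:R :> R by rewrite ltr0n.
have r_gt0 : 0 < m%:R * eps by rewrite mulr_gt0 // ltr0n.
have k2_ltN : (k2.*2 < n.+1)%N.
  by rewrite -(ltr_nat R) -muln2 natrM -ltr_pdivlMr.
pose C2 : R := 4 * (m%:R * eps) ^+ 4 / n.+1%:R ^+ 2.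
have C2_gt0 : 0 < C2 by apply: divr_gt0; [apply: mulr_gt0|]; rewrite ?exprn_gt0.
(* With $r=m\epsilon$, the gap over [C2] is $\lambda_1(n+1)/(4r^4)$; its square root cancels both
   the 2 and the $\sqrt{n+1}$ of the threshold. *)
have -> : a * (Num.sqrt lambda1 / (m%:R * eps) ^+ 2) =
    2 * (a / Num.sqrt n.+1%:R) * Num.sqrt (lambda1 / n.+1%:R / C2).
  set S := Num.sqrt n.+1%:R; set L := Num.sqrt lambda1.
  have S0 : 0 < S by rewrite sqrtr_gt0.
  have -> : lambda1 / n.+1%:R / C2 = (L * S / (2 * (m%:R * eps) ^+ 2)) ^+ 2.
    rewrite /C2 [in RHS]expr_div_n [(L * S) ^+ 2]exprMn /L /S !sqr_sqrtr ?ltW //.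
    move: n.+1%:R N0 (m%:R * eps) r_gt0 => N N0 r r0.
    by field; rewrite !gt_eqF.
  rewrite sqrtr_sqr ger0_norm; last first.
    by apply: divr_ge0; apply: mulr_ge0; rewrite ?sqrtr_ge0 ?sqr_ge0.
  move: (m%:R * eps) r_gt0 => r r0.
  by field; rewrite !gt_eqF.
apply: (upper_deviation_le (P := glauber nu Q)) => //.
- exact: path_measure_prob.
- by move=> x y; exact: glauber_ge0.
- by move=> x y; exact: glauber_rev.
- by rewrite divr_gt0.
- by move=> x; apply: spectral_power_lip => //; exact: ltW.
- by rewrite divr_ge0 ?sqrtr_ge0.
Qed.
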